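(* Let $\mathcal{C}$ be a category with finite products and weak equalisers in which every object is a choice object. If $\mathcal{C}$ is closed for pseudo-relations, then its exact completion $\mathcal{C}_{ex}$ is locally cartesian closed.
   Context: A weak limit is defined like a limit but without requiring uniqueness of the mediating arrow. Global elements: an arrow $x\colon 1\to X$ from the terminal object is written $x\in X$. For $f\colon X\to Y$ and $y\in Y$ write $y\in_f$ (i.e. ''$y$ is in the image of $f$'') if there is $x\in X$ with $fx=y$. An arrow $f\colon X\to Y$ is surjective if $y\in_f$ for every $y\in Y$. An object $Y$ is a choice object if every surjection with codomain $Y$ has a section. An arbitrary (not necessarily monic) arrow into a product is called a pseudo-relation. Families of pseudo-relations: given arrows $g\colon Y\to X$ and $f\colon X\to I$, a family of pseudo-relations over $f,g$ is a pair of arrows $h\colon J\to I$, $r\colon R\to J\times X\times Y$ such that (a) for all $j\in J,x\in X,y\in Y$: $\langle j,x,y\rangle\in_r$ implies $gy=x$; (b) for all $j\in J,x\in X$: $fx=hj$ iff there is $y\in Y$ with $\langle j,x,y\rangle\in_r$. A pseudo-relation over $f,g$ with domain index $i\in I$ is an arrow $r\colon R\to X\times Y$ such that for all $x\in X,y\in Y$: $\langle x,y\rangle\in_r$ implies $gy=x$, and $fx=i$ iff there is $y\in Y$ with $\langle x,y\rangle\in_r$. A full family of pseudo-relations over $f,g$ is a family of pseudo-relations $\phi\colon F\to I$, $\alpha\colon P\to F\times X\times Y$ over $f,g$ such that for every pseudo-relation $r\colon R\to X\times Y$ over $f,g$ with domain index $i\in I$ there is $c\in F$ with $\phi c=i$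 and, for all $x\in X,y\in Y$, $\langle c,x,y\rangle\in_\alpha$ implies $\langle x,y\rangle\in_r$. The category is closed for pseudo-relations if there is a full family of pseudo-relations over every pair of composable arrows $Y\xrightarrow{g}X\xrightarrow{f}I$. Exact completion: a pseudo-equivalence relation on $X$ in $\mathcal{C}$ is an arrow $r=\langle r_1,r_2\rangle\colon R\to X\times X$ for which there exist (not necessarily unique) arrows $\rho\colon X\to R$ with $r\rho=\langle 1_X,1_X\rangle$, $\sigma\colon R\to R$ with $r\sigma=\langle r_2,r_1\rangle$, and $\tau\colon Q\to R$ with $r\tau=\langle r_1p_1,r_2p_2\rangle$, where $(Q,p_1,p_2)$ is a weak pullback of $r_2$ and $r_1$. The category $\mathcal{C}_{ex}$ has as objects the pseudo-equivalence relations of $\mathcal{C}$; an arrow from $r\colon R\to X\times X$ to $s\colon S\to Y\times Y$ is an equivalence class $[f]$ of arrows $f\colon X\to Y$ of $\mathcal{C}$ for which some $\hat f\colon R\to S$ satisfies $s\hat f=(f\times f)r$, where $f,g$ are identified when some $h\colon X\to S$ satisfies $sh=\langle f,g\rangle$; composition is induced by that of $\mathcal{C}$. *)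

(* Defs.v *)
From HB Require Import structures.
From mathcomp Require Import all_boot boolp.

Set Implicit Arguments.
Unset Strict Implicit.
Unset Printing Implicit Defensive.

Declare Scope cat_scope.
Delimit Scope cat_scope with cat.
Local Open Scope quotient_scope.
Local Open Scope cat_scope.

Record category := Category {
  obj :> Type;
  hom : obj -> obj -> Type;
  idm : forall X, hom X X;
  comp : forall X Y Z, hom Y Z -> hom X Y -> hom X Z;
  comp_idl : forall X Y (f : hom X Y), comp (idm Y) f = f;
  comp_idr : forall X Y (f : hom X Y), comp f (idm X) = f;
  comp_assoc : forall W X Y Z (h : hom Y Z) (g : hom X Y) (f : hom W X),
    comp h (comp g f) = comp (comp h g) f }.

Arguments hom {c} X Y.
Arguments idm {c} X.
Arguments comp {c X Y Z} g f.

Notation "X ~> Y" := (hom X Y) (at level 90, Y at level 89) : cat_scope.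
Notation "g ∘ f" := (comp g f) (at level 40, left associativity) : cat_scope.

Record finite_products (C : category) := FiniteProducts {
  one : C;
  bang : forall X, X ~> one;
  bang_uniq : forall X (f : X ~> one), f = bang X;
  prod_obj : C -> C -> C;
  pr1 : forall X Y, prod_obj X Y ~> X;
  pr2 : forall X Y, prod_obj X Y ~> Y;
  pairing : forall Z X Y, (Z ~> X) -> (Z ~> Y) -> (Z ~> prod_obj X Y);
  pr1_pairing : forall Z X Y (f : Z ~> X) (g : Z ~> Y), pr1 X Y ∘ pairing f g = f;
  pr2_pairing : forall Z X Y (f : Z ~> X) (g : Z ~> Y), pr2 X Y ∘ pairing f g = g;
  pairing_uniq : forall Z X Y (h : Z ~> prod_obj X Y),
    h = pairing (pr1 X Y ∘ h) (pr2 X Y ∘ h) }.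

Arguments one {C} _.
Arguments prod_obj {C} _ X Y.
Arguments pr1 {C _} X Y.
Arguments pr2 {C _} X Y.
Arguments pairing {C _ Z X Y} _ _.

Notation "X ×[ P ] Y" := (prod_obj P X Y)
  (at level 40, left associativity, format "X  ×[ P ]  Y") : cat_scope.
Notation "⟨ f , g ⟩" := (pairing f g) (at level 0, format "⟨ f ,  g ⟩") : cat_scope.

Definition prod_map (C : category) (P : finite_products C) (X Y X' Y' : C)
    (f : X ~> X') (g : Y ~> Y') : X ×[P] Y ~> X' ×[P] Y' :=
  ⟨f ∘ pr1 X Y, g ∘ pr2 X Y⟩.

Section WeakLimits.
Variable C : category.

Definition is_weak_equaliser (X Y E : C) (f g : X ~> Y) (e : E ~> X) : Prop :=
  f ∘ e = g ∘ e /\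
  forall Z (h : Z ~> X), f ∘ h = g ∘ h -> exists k : Z ~> E, e ∘ k = h.

Definition has_weak_equalisers : Prop :=
  forall (X Y : C) (f g : X ~> Y),
    exists (E : C) (e : E ~> X), is_weak_equaliser f g e.

Definition is_weak_pullback (X Y Z Q : C) (f : X ~> Z) (g : Y ~> Z)
    (p1 : Q ~> X) (p2 : Q ~> Y) : Prop :=
  f ∘ p1 = g ∘ p2 /\
  forall W (a : W ~> X) (b : W ~> Y), f ∘ a = g ∘ b ->
    exists k : W ~> Q, p1 ∘ k = a /\ p2 ∘ k = b.

End WeakLimits.

Section GlobalElements.
Variables (C : category) (P : finite_products C).

Definition elt (X : C) : Type := one P ~> X.

Definition in_image (X Y : C) (f : X ~> Y) (y : elt Y) : Prop :=
  exists x : elt X, f ∘ x = y.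

Definition surjective_arrow (X Y : C) (f : X ~> Y) : Prop :=
  forall y : elt Y, in_image f y.

Definition choice_object (Y : C) : Prop :=
  forall (X : C) (f : X ~> Y), surjective_arrow f ->
    exists s : Y ~> X, f ∘ s = idm Y.

(* Triple products are bracketed as (J × X) × Y. *)

Definition is_pseudo_relation_family (Y X I J R : C) (g : Y ~> X) (f : X ~> I)
    (h : J ~> I) (r : R ~> J ×[P] X ×[P] Y) : Prop :=
  (forall (j : elt J) (x : elt X) (y : elt Y),
     in_image r ⟨⟨j, x⟩, y⟩ -> g ∘ y = x) /\
  (forall (j : elt J) (x : elt X),
     f ∘ x = h ∘ j <-> exists y : elt Y, in_image r ⟨⟨j, x⟩, y⟩).

Definition is_pseudo_relation_over (Y X I R : C) (g : Y ~> X) (f : X ~> I)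
    (i : elt I) (r : R ~> X ×[P] Y) : Prop :=
  (forall (x : elt X) (y : elt Y), in_image r ⟨x, y⟩ -> g ∘ y = x) /\
  (forall x : elt X, f ∘ x = i <-> exists y : elt Y, in_image r ⟨x, y⟩).

Definition is_full_family (Y X I F Pf : C) (g : Y ~> X) (f : X ~> I)
    (phi : F ~> I) (alpha : Pf ~> F ×[P] X ×[P] Y) : Prop :=
  is_pseudo_relation_family g f phi alpha /\
  forall (i : elt I) (R : C) (r : R ~> X ×[P] Y),
    is_pseudo_relation_over g f i r ->
    exists c : elt F, phi ∘ c = i /\
      forall (x : elt X) (y : elt Y),
        in_image alpha ⟨⟨c, x⟩, y⟩ -> in_image r ⟨x, y⟩.

Definition closed_for_pseudo_relations : Prop :=
  forall (Y X I : C) (g : Y ~> X) (f : X ~> I),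
    exists (F Pf : C) (phi : F ~> I) (alpha : Pf ~> F ×[P] X ×[P] Y),
      is_full_family g f phi alpha.

End GlobalElements.

Section ExactCompletion.
Variables (C : category) (P : finite_products C).

Definition is_pseudo_equivalence (X R : C) (r : R ~> X ×[P] X) : Prop :=
  let r1 := pr1 X X ∘ r in
  let r2 := pr2 X X ∘ r in
  [/\ exists rho : X ~> R, r ∘ rho = ⟨idm X, idm X⟩,
      exists sigma : R ~> R, r ∘ sigma = ⟨r2, r1⟩
    & exists (Q : C) (p1 p2 : Q ~> R), is_weak_pullback r2 r1 p1 p2 /\
        exists tau : Q ~> R, r ∘ tau = ⟨r1 ∘ p1, r2 ∘ p2⟩].

Record per_obj := PerObj {
  per_base : C;
  per_dom : C;
  per_rel : per_dom ~> per_base ×[P] per_base;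
  per_axiom : is_pseudo_equivalence per_rel }.

Record tracked (r s : per_obj) := Tracked {
  tfun :> per_base r ~> per_base s;
  tfun_axiom : exists fhat : per_dom r ~> per_dom s,
    per_rel s ∘ fhat = prod_map P tfun tfun ∘ per_rel r }.

HB.instance Definition _ (r s : per_obj) := gen_eqMixin (tracked r s).
HB.instance Definition _ (r s : per_obj) := gen_choiceMixin (tracked r s).

Definition identified (r s : per_obj) (f g : tracked r s) : bool :=
  `[< exists h : per_base r ~> per_dom s, per_rel s ∘ h = ⟨tfun f, tfun g⟩ >].

Lemma pairing_comp (W Z X Y : C) (f : Z ~> X) (g : Z ~> Y) (k : W ~> Z) :
  ⟨f, g⟩ ∘ k = ⟨f ∘ k, g ∘ k⟩ :> (W ~> X ×[P] Y).
Proof.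
by rewrite (pairing_uniq (⟨f, g⟩ ∘ k)) !comp_assoc pr1_pairing pr2_pairing.
Qed.

Lemma prod_map_pairing (Z X Y X' Y' : C) (f : X ~> X') (g : Y ~> Y')
    (a : Z ~> X) (b : Z ~> Y) :
  prod_map P f g ∘ ⟨a, b⟩ = ⟨f ∘ a, g ∘ b⟩.
Proof.
by rewrite /prod_map pairing_comp -!comp_assoc pr1_pairing pr2_pairing.
Qed.

Lemma prod_map_id (X Y : C) : prod_map P (idm X) (idm Y) = idm (X ×[P] Y).
Proof.
by rewrite /prod_map !comp_idl [RHS]pairing_uniq !comp_idr.
Qed.

Lemma prod_map_comp (X Y Z X' Y' Z' : C) (g : Y ~> Z) (g' : Y' ~> Z')
    (f : X ~> Y) (f' : X' ~> Y') :
  prod_map P (g ∘ f) (g' ∘ f') = prod_map P g g' ∘ prod_map P f f'.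
Proof. by rewrite {3}/prod_map prod_map_pairing !comp_assoc. Qed.

Lemma identified_refl r s : reflexive (@identified r s).
Proof.
move=> f; apply/asboolP; case: (per_axiom s) => [[rho rhoE] _ _].
by exists (rho ∘ f); rewrite comp_assoc rhoE pairing_comp !comp_idl.
Qed.

Lemma identified_imp_sym r s (f g : tracked r s) :
  identified f g -> identified g f.
Proof.
move/asboolP => [h hE]; apply/asboolP.
case: (per_axiom s) => [_ [sigma sigmaE] _].
exists (sigma ∘ h); rewrite comp_assoc sigmaE pairing_comp -!comp_assoc hE.
by rewrite pr1_pairing pr2_pairing.
Qed.

Lemma identified_sym r s : symmetric (@identified r s).
Proof. by move=> f g; apply/idP/idP; apply: identified_imp_sym. Qed.

Lemma identified_trans r s : transitive (@identified r s).
Proof.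
move=> g f h /asboolP[k kE] /asboolP[l lE]; apply/asboolP.
case: (per_axiom s) => [_ _ [Q [p1 [p2 [[_ wpb] [tau tauE]]]]]].
have [|m [p1m p2m]] := wpb _ k l.
  by rewrite -!comp_assoc kE lE pr1_pairing pr2_pairing.
exists (tau ∘ m); rewrite comp_assoc tauE pairing_comp -!comp_assoc p1m p2m.
by rewrite kE lE pr1_pairing pr2_pairing.
Qed.

Canonical identified_equiv r s := EquivRel (@identified r s)
  (@identified_refl r s) (@identified_sym r s) (@identified_trans r s).

Definition ex_hom (r s : per_obj) : Type := {eq_quot @identified r s}.

Lemma tracked_id_axiom (r : per_obj) : exists fhat : per_dom r ~> per_dom r,
  per_rel r ∘ fhat = prod_map P (idm (per_base r)) (idm _) ∘ per_rel r.
Proof. by exists (idm _); rewrite prod_map_id comp_idl comp_idr. Qed.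

Definition tracked_id (r : per_obj) : tracked r r :=
  Tracked (tracked_id_axiom r).

Lemma tracked_comp_axiom (r s t : per_obj) (g : tracked s t) (f : tracked r s) :
  exists fhat : per_dom r ~> per_dom t,
    per_rel t ∘ fhat = prod_map P (g ∘ f) (g ∘ f) ∘ per_rel r.
Proof.
case: g f => [g [ghat gE]] [f [fhat fE]] /=.
by exists (ghat ∘ fhat); rewrite comp_assoc gE -comp_assoc fE prod_map_comp
  comp_assoc.
Qed.

Definition tracked_comp (r s t : per_obj) (g : tracked s t) (f : tracked r s) :
  tracked r t := Tracked (tracked_comp_axiom g f).

Definition ex_id (r : per_obj) : ex_hom r r :=
  \pi_({eq_quot @identified r r}) (tracked_id r).

Definition ex_comp (r s t : per_obj) (g : ex_hom s t) (f : ex_hom r s) :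
  ex_hom r t :=
  \pi_({eq_quot @identified r t}) (tracked_comp (repr g) (repr f)).

Lemma ex_comp_pi (r s t : per_obj) (g : tracked s t) (f : tracked r s) :
  ex_comp (\pi_({eq_quot @identified s t}) g)
          (\pi_({eq_quot @identified r s}) f) =
  \pi_({eq_quot @identified r t}) (tracked_comp g f).
Proof.
rewrite /ex_comp; apply/eqmodP; rewrite /=.
set g' := repr _; set f' := repr _.
have /asboolP[k kE] : identified g' g by apply/eqmodP; rewrite reprK.
have /asboolP[h hE] : identified f' f by apply/eqmodP; rewrite reprK.
have [ghat gE] := tfun_axiom g.
apply: (@identified_trans r t (tracked_comp g f')); apply/asboolP => /=.
  by exists (k ∘ f'); rewrite comp_assoc kE pairing_comp.
by exists (ghat ∘ h); rewrite comp_assoc gE -comp_assoc hE prod_map_pairing.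
Qed.

Lemma tracked_eq (r s : per_obj) (f g : tracked r s) :
  tfun f = tfun g -> f = g.
Proof.
by case: f g => [f pf] [g pg] /= E; subst g; congr Tracked; apply: Prop_irrelevance.
Qed.

Lemma ex_comp_idl (r s : per_obj) (f : ex_hom r s) : ex_comp (ex_id s) f = f.
Proof.
rewrite -[f]reprK /ex_id ex_comp_pi; congr (\pi_ _ _).
by apply: tracked_eq; rewrite /= comp_idl.
Qed.

Lemma ex_comp_idr (r s : per_obj) (f : ex_hom r s) : ex_comp f (ex_id r) = f.
Proof.
rewrite -[f]reprK /ex_id ex_comp_pi; congr (\pi_ _ _).
by apply: tracked_eq; rewrite /= comp_idr.
Qed.

Lemma ex_comp_assoc (r s t u : per_obj)
    (h : ex_hom t u) (g : ex_hom s t) (f : ex_hom r s) :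
  ex_comp h (ex_comp g f) = ex_comp (ex_comp h g) f.
Proof.
rewrite -[h]reprK -[g]reprK -[f]reprK.
rewrite (ex_comp_pi (repr g) (repr f)) (ex_comp_pi (repr h) (repr g)) !ex_comp_pi.
congr (\pi_ _ _).
by apply: tracked_eq; rewrite /= comp_assoc.
Qed.

Definition exact_completion : category :=
  Category ex_comp_idl ex_comp_idr ex_comp_assoc.

End ExactCompletion.

Section Slice.
Variables (C : category) (I : C).

Record slice_obj := SliceObj { slice_dom : C; slice_map : slice_dom ~> I }.

Definition slice_hom (a b : slice_obj) : Type :=
  {h : slice_dom a ~> slice_dom b | slice_map b ∘ h = slice_map a}.

Definition slice_id (a : slice_obj) : slice_hom a a :=
  exist _ (idm _) (comp_idr (slice_map a)).

Lemma slice_comp_axiom (a b c : slice_obj)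
    (k : slice_hom b c) (h : slice_hom a b) :
  slice_map c ∘ (sval k ∘ sval h) = slice_map a.
Proof. by rewrite comp_assoc (svalP k) (svalP h). Qed.

Definition slice_comp (a b c : slice_obj)
    (k : slice_hom b c) (h : slice_hom a b) : slice_hom a c :=
  exist _ (sval k ∘ sval h) (slice_comp_axiom k h).

Lemma slice_hom_eq (a b : slice_obj) (h k : slice_hom a b) :
  sval h = sval k -> h = k.
Proof. by case: h k => [h hE] [k kE] /= E; apply: eq_exist. Qed.

Lemma slice_comp_idl (a b : slice_obj) (h : slice_hom a b) :
  slice_comp (slice_id b) h = h.
Proof. by apply: slice_hom_eq; rewrite /= comp_idl. Qed.

Lemma slice_comp_idr (a b : slice_obj) (h : slice_hom a b) :
  slice_comp h (slice_id a) = h.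
Proof. by apply: slice_hom_eq; rewrite /= comp_idr. Qed.

Lemma slice_comp_assoc (a b c d : slice_obj)
    (l : slice_hom c d) (k : slice_hom b c) (h : slice_hom a b) :
  slice_comp l (slice_comp k h) = slice_comp (slice_comp l k) h.
Proof. by apply: slice_hom_eq; rewrite /= comp_assoc. Qed.

Definition slice : category :=
  Category slice_comp_idl slice_comp_idr slice_comp_assoc.

End Slice.

Definition is_exponential (C : category) (P : finite_products C) (A B E : C)
    (ev : E ×[P] A ~> B) : Prop :=
  forall (Z : C) (f : Z ×[P] A ~> B),
    exists! h : Z ~> E, ev ∘ prod_map P h (idm A) = f.

Definition cartesian_closed (C : category) : Prop :=
  exists P : finite_products C, forall A B : C,
    exists (E : C) (ev : E ×[P] A ~> B), is_exponential ev.

Definition has_terminal (C : category) : Prop :=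
  exists T : C, forall X : C, exists! f : X ~> T, True.

(* Binary products in the slices are the pullbacks of C, so together with the
   terminal object C has all finite limits. *)
Definition locally_cartesian_closed (C : category) : Prop :=
  has_terminal C /\ forall I : C, cartesian_closed (slice I).

(* Main.v *)
(* Weak equalisers and choice make [C] well pointed: arrows are determined by
   global elements, and [f] factors through [g] as soon as it does so on each
   element.  Call a predicate on the elements of [X] definable when it is the
   image of an arrow into [X].  Weak limits give closure of definable predicates
   under conjunction, equality and existential quantification; full families of
   pseudo-relations give implication and universal quantification.  An object of
   the exact completion is then a definable equivalence relation on the elements
   of its base, and an arrow is a definable functional relation.  To build the
   exponential of [A] and [B] over [I], take a full family of total relations
   between the fibres of [A] and [B], restrict it to the indices whose relation
   is functional (a definable condition), and identify indices whose relations
   represent the same function. *)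
From HB Require Import structures.
From mathcomp Require Import all_boot boolp.
Require Import Defs.

Set Implicit Arguments.
Unset Strict Implicit.
Unset Printing Implicit Defensive.

Local Open Scope quotient_scope.
Local Open Scope cat_scope.

Section ExactCompletionLCC.
Variables (C : category) (P : finite_products C).
Local Notation elt := (elt P).

(** * Global elements and pointwise lifting *)

Lemma pairing_eta (X Y : C) (w : elt (X ×[P] Y)) :
  ⟨pr1 X Y ∘ w, pr2 X Y ∘ w⟩ = w.
Proof. by rewrite -pairing_uniq. Qed.

Lemma elt_cst (Z : C) (X : C) (c : elt X) (z : elt Z) :
  c ∘ bang P Z ∘ z = c.
Proof.
rewrite -comp_assoc (bang_uniq (bang P Z ∘ z)).
by rewrite -(bang_uniq (@idm C (one P))) comp_idr.
Qed.

Hypotheses (weq : has_weak_equalisers C)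
  (choiceC : forall Y : C, choice_object P Y).

Lemma weak_pullback_exists (X Y Z : C) (f : X ~> Z) (g : Y ~> Z) :
  exists (Q : C) (p1 : Q ~> X) (p2 : Q ~> Y), is_weak_pullback f g p1 p2.
Proof.
have [Q [e [eqe univ]]] := weq (f ∘ @pr1 C P X Y) (g ∘ pr2 X Y).
exists Q, (pr1 X Y ∘ e), (pr2 X Y ∘ e); split; first by rewrite !comp_assoc.
move=> W a b ab; have [|k ek] := univ W ⟨a, b⟩.
  by rewrite -!comp_assoc pr1_pairing pr2_pairing.
by exists k; rewrite -!comp_assoc ek pr1_pairing pr2_pairing.
Qed.

(* The weak pullback of [g] along [f] is surjective onto [X], hence split. *)
Lemma pointwise_lift (X Y Z : C) (f : X ~> Z) (g : Y ~> Z) :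
  (forall x : elt X, in_image g (f ∘ x)) -> exists h : X ~> Y, g ∘ h = f.
Proof.
move=> fg; have [Q [p1 [p2 [p12 univ]]]] := weak_pullback_exists f g.
have [|s p1s] := choiceC (f := p1).
  move=> x; have [y gy] := fg x.
  by have [k [p1k _]] := univ _ x y (esym gy); exists k.
by exists (p2 ∘ s); rewrite comp_assoc -p12 -comp_assoc p1s comp_idr.
Qed.

(** * Definable predicates: equality, conjunction, existence *)

Definition definable (X : C) (S : elt X -> Prop) : Prop :=
  exists (R : C) (r : R ~> X), forall x, in_image r x <-> S x.

(** Asking that [t] come from an arrow lets formulas keep ordinary variables while substitution is
    still a weak pullback. *)
Definition is_term (X Y : C) (t : elt X -> elt Y) : Prop :=
  exists f : X ~> Y, forall x, t x = f ∘ x.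

Lemma term_id (X : C) : is_term (fun x : elt X => x).
Proof. by exists (idm X) => x; rewrite comp_idl. Qed.

Lemma term_cst (X Y : C) (c : elt Y) : is_term (fun _ : elt X => c).
Proof. by exists (c ∘ bang P X) => x; rewrite elt_cst. Qed.

Lemma term_comp (X Y Z : C) (f : Y ~> Z) (t : elt X -> elt Y) :
  is_term t -> is_term (fun x => f ∘ t x).
Proof. by case=> g gE; exists (f ∘ g) => x; rewrite gE comp_assoc. Qed.

Lemma term_pair (X Y Z : C) (t : elt X -> elt Y) (u : elt X -> elt Z) :
  is_term t -> is_term u -> is_term (fun x => ⟨t x, u x⟩ : elt (Y ×[P] Z)).
Proof.
by case=> f fE [g gE]; exists ⟨f, g⟩ => x; rewrite fE gE pairing_comp.
Qed.

Lemma definable_eq (X Y : C) (t u : elt X -> elt Y) :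
  is_term t -> is_term u -> definable (fun x => t x = u x).
Proof.
case=> f fE [g gE]; have [E [e [eqe univ]]] := weq f g.
exists E, e => x; rewrite fE gE; split=> [[z <-]|/univ//].
by rewrite !comp_assoc eqe.
Qed.

Lemma definable_subst (X Y : C) (S : elt Y -> Prop) (t : elt X -> elt Y) :
  definable S -> is_term t -> definable (fun x => S (t x)).
Proof.
case=> R [r rS] [f fE]; have [Q [p1 [p2 [p12 univ]]]] := weak_pullback_exists f r.
exists Q, p1 => x; rewrite fE -rS; split=> [[z <-]|[y ry]].
  by exists (p2 ∘ z); rewrite !comp_assoc p12.
by have [k [p1k _]] := univ _ x y (esym ry); exists k.
Qed.

Lemma definable_image (X Y R : C) (r : R ~> Y) (t : elt X -> elt Y) :
  is_term t -> definable (fun x => in_image r (t x)).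
Proof. by apply: definable_subst; exists R, r. Qed.

Lemma definable_and (X : C) (S T : elt X -> Prop) :
  definable S -> definable T -> definable (fun x => S x /\ T x).
Proof.
case=> R [r rS] [R' [r' rT]].
have [Q [p1 [p2 [p12 univ]]]] := weak_pullback_exists r r'.
exists Q, (r ∘ p1) => x; rewrite -rS -rT; split=> [[z <-]|[[y ry] [y' ry']]].
  by split; [exists (p1 ∘ z)|exists (p2 ∘ z)]; rewrite comp_assoc // -p12.
have [|k [p1k _]] := univ _ y y'; first by rewrite ry ry'.
by exists k; rewrite -comp_assoc p1k.
Qed.

Definition definable2 (X Y : C) (S : elt X -> elt Y -> Prop) : Prop :=
  definable (fun w : elt (X ×[P] Y) => S (pr1 X Y ∘ w) (pr2 X Y ∘ w)).

Definition definable3 (X Y Z : C) (S : elt X -> elt Y -> elt Z -> Prop) : Prop :=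
  definable2 (fun (w : elt (X ×[P] Y)) z => S (pr1 X Y ∘ w) (pr2 X Y ∘ w) z).

Lemma definable2_subst (W X Y : C) (S : elt X -> elt Y -> Prop)
    (t : elt W -> elt X) (u : elt W -> elt Y) :
  definable2 S -> is_term t -> is_term u -> definable (fun w => S (t w) (u w)).
Proof.
move=> dS dt du; have := definable_subst dS (term_pair dt du).
by congr (definable _); apply: funext => w; rewrite pr1_pairing pr2_pairing.
Qed.

Lemma definable3_subst (W X Y Z : C) (S : elt X -> elt Y -> elt Z -> Prop)
    (t : elt W -> elt X) (u : elt W -> elt Y) (v : elt W -> elt Z) :
  definable3 S -> is_term t -> is_term u -> is_term v ->
  definable (fun w => S (t w) (u w) (v w)).
Proof.
move=> dS dt du dv; have := definable2_subst
  (S := fun w => S (pr1 X Y ∘ w) (pr2 X Y ∘ w)) dS (term_pair dt du) dv.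
by congr (definable _); apply: funext => w; rewrite pr1_pairing pr2_pairing.
Qed.

Lemma definable_ex (X Y : C) (S : elt X -> elt Y -> Prop) :
  definable2 S -> definable (fun x => exists y, S x y).
Proof.
case=> R [r rS]; exists R, (pr1 X Y ∘ r) => x; split=> [[z <-]|[y Sxy]].
  have /rS Sz : in_image r (r ∘ z) by exists z.
  by exists (pr2 X Y ∘ (r ∘ z)); rewrite -comp_assoc.
have [|z rz] := (rS ⟨x, y⟩).2; first by rewrite pr1_pairing pr2_pairing.
by exists z; rewrite -comp_assoc rz pr1_pairing.
Qed.

(* A total definable relation from [X] projects surjectively to [X]; a section
   of that projection picks out an arrow. *)
Lemma definable_choice (X Y : C) (S : elt X -> elt Y -> Prop) :
  definable2 S -> (forall x, exists y, S x y) ->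
  exists f : X ~> Y, forall x, S x (f ∘ x).
Proof.
case=> R [r rS] tot; have [|s sE] := choiceC (f := pr1 X Y ∘ r).
  move=> x; have [y Sxy] := tot x.
  have [|z rz] := (rS ⟨x, y⟩).2; first by rewrite pr1_pairing pr2_pairing.
  by exists z; rewrite -comp_assoc rz pr1_pairing.
exists (pr2 X Y ∘ r ∘ s) => x.
have /rS : in_image r (r ∘ (s ∘ x)) by exists (s ∘ x).
by rewrite !comp_assoc sE comp_idl.
Qed.

(** * Universal quantification and implication *)

Hypothesis closedC : closed_for_pseudo_relations P.

(* An index [i] carries a pseudo-relation over [f, g] iff the fibre of [f] over
   [i] lies in the image of [g]; hence the base of a full family presents the
   universal quantification along [f]. *)
Lemma definable_all_along (X I : C) (S : elt X -> Prop) (f : X ~> I) :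
  definable S -> definable (fun i => forall x, f ∘ x = i -> S x).
Proof.
case=> Y [g gS]; have [F [Pf [phi [alpha [[fam1 fam2] full]]]]] := closedC g f.
exists F, phi => i; split=> [[c ci] x|alli].
  rewrite -ci => /fam2 [y /fam1 gy]; apply/gS; by exists y.
(* The largest candidate over [i]; it is total on the fibre because every [x] there satisfies [S]
   and so lies in the image of [g]. *)
have [R [r rE]] : definable (fun w : elt (X ×[P] Y) =>
    f ∘ (pr1 X Y ∘ w) = i /\ g ∘ (pr2 X Y ∘ w) = pr1 X Y ∘ w).
  apply: definable_and; apply: definable_eq; by do ?[exact: term_id
    |exact: term_cst|apply: term_comp].
have [|c [ci _]] := full i R r; last by exists c.
split=> [x y|x]; first by rewrite rE pr1_pairing pr2_pairing => -[].
split=> [fx|[y]]; last by rewrite rE pr1_pairing pr2_pairing => -[].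
have /gS[y gy] := alli x fx.
by exists y; rewrite rE pr1_pairing pr2_pairing.
Qed.

Lemma definable_all (X Y : C) (S : elt X -> elt Y -> Prop) :
  definable2 S -> definable (fun x => forall y, S x y).
Proof.
move=> dS; have := definable_all_along (pr1 X Y) dS.
congr (definable _); apply: funext => x; apply: propext; split=> [Sx y|Sx w wx].
  by have := Sx ⟨x, y⟩; rewrite pr1_pairing pr2_pairing; apply.
by rewrite wx; apply: Sx.
Qed.

(** If [d] presents [S], the implication says that [T (d z)] holds for all [z] over [x], a
    quantification along [d]. *)
Lemma definable_imp (X : C) (S T : elt X -> Prop) :
  definable S -> definable T -> definable (fun x => S x -> T x).
Proof.
case=> D [d dS] dT.
have dTd : definable (fun z : elt D => T (d ∘ z)).
  by apply: definable_subst => //; apply: term_comp; exact: term_id.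
have := definable_all_along d dTd.
congr (definable _); apply: funext => x; apply: propext.
split=> [H /dS[z zx]|H z zx]; first by rewrite -zx; apply: H.
by rewrite zx; apply: H; apply/dS; exists z.
Qed.

(** Presents a relation as a span, since closure for pseudo-relations takes arrows rather than
    predicates. *)
Lemma definable2_cover (X Y : C) (S : elt X -> elt Y -> Prop) :
  definable2 S -> exists (R : C) (p : R ~> X) (q : R ~> Y),
    (forall z : elt R, S (p ∘ z) (q ∘ z)) /\
    (forall x y, S x y -> exists z : elt R, p ∘ z = x /\ q ∘ z = y).
Proof.
case=> R [r rS]; exists R, (pr1 X Y ∘ r), (pr2 X Y ∘ r); split=> [z|x y Sxy].
  by have /rS : in_image r (r ∘ z); [exists z|rewrite !comp_assoc].
have [|z rz] := (rS ⟨x, y⟩).2; first by rewrite pr1_pairing pr2_pairing.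
by exists z; rewrite -!comp_assoc rz pr1_pairing pr2_pairing.
Qed.

(** * Elements of the exact completion *)

Local Notation Cex := (exact_completion P).

Definition eqv (r : Cex) (x y : elt (per_base r)) : Prop :=
  in_image (per_rel r) ⟨x, y⟩.
Local Notation "x ≈ y" := (eqv x y) (at level 70).

(** Uses a chosen representative of the class [f], so its laws hold only up to [≈]. *)
Definition app (r s : Cex) (f : r ~> s) (x : elt (per_base r)) :
  elt (per_base s) := tfun (repr f) ∘ x.

Lemma definable_eqv (X : C) (r : Cex) (t u : elt X -> elt (per_base r)) :
  is_term t -> is_term u -> definable (fun x => t x ≈ u x).
Proof. by move=> dt du; apply: definable_image; apply: term_pair. Qed.

Lemma term_app (X : C) (r s : Cex) (f : r ~> s) (t : elt X -> elt (per_base r)) :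
  is_term t -> is_term (fun x => app f (t x)).
Proof. exact: term_comp. Qed.

Ltac solve_term := first
  [ exact: term_id | exact: term_cst | apply: term_pair; solve_term
  | apply: term_app; solve_term | apply: term_comp; solve_term ].

Ltac solve_definable := lazymatch goal with
  | |- definable3 _ => rewrite /definable3; solve_definable
  | |- definable2 _ => rewrite /definable2; solve_definable
  | |- definable (fun w => _ /\ _) => apply: definable_and; solve_definable
  | |- definable (fun w => _ ≈ _) => apply: definable_eqv; solve_term
  | |- definable (fun w => _ = _) => apply: definable_eq; solve_term
  | |- definable (fun w => in_image _ _) => apply: definable_image; solve_term
  | |- definable (fun w => exists y, _) => apply: definable_ex; solve_definable
  | |- definable (fun w => forall y : elt _, _) =>
      apply: definable_all; solve_definable
  | |- definable (fun w => _ -> _) => apply: definable_imp; solve_definable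
  | _ => match goal with
    | H : definable2 _ |- _ => apply: (definable2_subst H); solve_term
    | H : definable3 _ |- _ => apply: (definable3_subst H); solve_term
    end
  end.

Lemma eqv_refl (r : Cex) (x : elt (per_base r)) : x ≈ x.
Proof.
case: (per_axiom r) => [[rho rhoE] _ _]; exists (rho ∘ x).
by rewrite comp_assoc rhoE pairing_comp !comp_idl.
Qed.

Lemma eqv_sym (r : Cex) (x y : elt (per_base r)) : x ≈ y -> y ≈ x.
Proof.
case: (per_axiom r) => [_ [sigma sigmaE] _] [z zE]; exists (sigma ∘ z).
by rewrite comp_assoc sigmaE pairing_comp -!comp_assoc zE pr1_pairing pr2_pairing.
Qed.

Lemma eqv_trans (r : Cex) (y x z : elt (per_base r)) : x ≈ y -> y ≈ z -> x ≈ z.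
Proof.
case: (per_axiom r) => [_ _ [Q [p1 [p2 [[_ univ] [tau tauE]]]]]] [u uE] [v vE].
have [|w [wu wv]] := univ _ u v.
  by rewrite -!comp_assoc uE vE pr1_pairing pr2_pairing.
exists (tau ∘ w); rewrite comp_assoc tauE pairing_comp -!comp_assoc wu wv uE vE.
by rewrite pr1_pairing pr2_pairing.
Qed.

Lemma app_eqv (r s : Cex) (f : r ~> s) (x y : elt (per_base r)) :
  x ≈ y -> app f x ≈ app f y.
Proof.
case: (tfun_axiom (repr f)) => [fhat fE] [z zE]; exists (fhat ∘ z).
by rewrite comp_assoc fE -comp_assoc zE prod_map_pairing.
Qed.

Lemma app_pi (r s : Cex) (f : tracked r s) (x : elt (per_base r)) :
  app (\pi_({eq_quot @identified C P r s}) f : r ~> s) x ≈ tfun f ∘ x.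
Proof.
have /asboolP[h hE] : identified (repr (\pi_({eq_quot @identified C P r s}) f)) f.
  by apply/eqmodP; rewrite reprK.
by exists (h ∘ x); rewrite comp_assoc hE pairing_comp.
Qed.

Lemma app_id (r : Cex) (x : elt (per_base r)) : app (idm r) x ≈ x.
Proof. by have := app_pi (tracked_id r) x; rewrite /= comp_idl. Qed.

Lemma app_comp (r s t : Cex) (g : s ~> t) (f : r ~> s) (x : elt (per_base r)) :
  app (g ∘ f) x ≈ app g (app f x).
Proof.
by have := app_pi (tracked_comp (repr g) (repr f)) x; rewrite /= -comp_assoc.
Qed.

(** The elementwise witnesses of [≈] assemble into one arrow by [pointwise_lift]. *)
Lemma app_ext (r s : Cex) (f g : r ~> s) :
  (forall x, app f x ≈ app g x) -> f = g.
Proof.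
move=> fg; rewrite -[f]reprK -[g]reprK; apply/eqmodP; apply/asboolP.
by apply: pointwise_lift => x; rewrite pairing_comp; apply: fg.
Qed.

(** Choice extracts an arrow [t] from [S]; single-valuedness up to [≈] makes [t] preserve [≈] on
    elements, and [pointwise_lift] then yields the tracking arrow. *)
Lemma ex_hom_of_relation (r s : Cex)
    (S : elt (per_base r) -> elt (per_base s) -> Prop) :
  definable2 S -> (forall x, exists y, S x y) ->
  (forall x x' y y', x ≈ x' -> S x y -> S x' y' -> y ≈ y') ->
  exists f : r ~> s, forall x y, S x y -> app f x ≈ y.
Proof.
move=> dS tot resp; have [t tS] := definable_choice dS tot.
have trk : exists fhat, per_rel s ∘ fhat = prod_map P t t ∘ per_rel r.
  apply: pointwise_lift => w; rewrite -comp_assoc -[_ ∘ w]pairing_eta.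
  rewrite prod_map_pairing; apply: resp (tS _) (tS _).
  by exists w; rewrite pairing_eta.
exists (\pi_({eq_quot @identified C P r s}) (Tracked trk)) => x y Sxy.
by apply: eqv_trans (app_pi _ _) _; apply: resp (eqv_refl x) (tS x) Sxy.
Qed.

(** * Objects built from definable equivalence relations *)

Lemma pseudo_equivalence_of_elements (X R : C) (r : R ~> X ×[P] X) :
  (forall x : elt X, in_image r ⟨x, x⟩) ->
  (forall x y : elt X, in_image r ⟨x, y⟩ -> in_image r ⟨y, x⟩) ->
  (forall x y z : elt X, in_image r ⟨x, y⟩ -> in_image r ⟨y, z⟩ ->
     in_image r ⟨x, z⟩) ->
  is_pseudo_equivalence r.
Proof.
move=> refl sym trans; split.
- by apply: pointwise_lift => x; rewrite pairing_comp comp_idl.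
- apply: pointwise_lift => w; rewrite pairing_comp; apply: sym.
  by exists w; rewrite -!comp_assoc pairing_eta.
- have [Q [p1 [p2 wpb]]] := weak_pullback_exists (pr2 X X ∘ r) (pr1 X X ∘ r).
  exists Q, p1, p2; split=> //; apply: pointwise_lift => w; rewrite pairing_comp.
  apply: (trans _ (pr2 X X ∘ r ∘ p1 ∘ w)); [exists (p1 ∘ w)|exists (p2 ∘ w)].
    by rewrite -!comp_assoc pairing_eta.
  by rewrite wpb.1 -!comp_assoc pairing_eta.
Qed.

(** Source of the terminal object, the pullbacks and the exponentials. The base is any arrow [m]
    presenting [D]; its repeated elements become equivalent because [Q] is reflexive on [D]. *)
Lemma subquotient_exists (X : C) (D : elt X -> Prop) (Q : elt X -> elt X -> Prop) :
  definable D -> definable2 Q ->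
  (forall x, D x -> Q x x) ->
  (forall x y, D x -> D y -> Q x y -> Q y x) ->
  (forall x y z, D x -> D y -> D z -> Q x y -> Q y z -> Q x z) ->
  exists (E : Cex) (m : per_base E ~> X),
    [/\ forall c : elt (per_base E), D (m ∘ c),
        forall x, D x -> exists c : elt (per_base E), m ∘ c = x
      & forall c d : elt (per_base E), c ≈ d <-> Q (m ∘ c) (m ∘ d)].
Proof.
case=> X' [m mD] dQ refl sym trans.
have Dm c : D (m ∘ c) by apply/mD; exists c.
have [R [r rE]] : definable2 (fun c d : elt X' => Q (m ∘ c) (m ∘ d)).
  by solve_definable.
have {}rE c d : in_image r ⟨c, d⟩ <-> Q (m ∘ c) (m ∘ d).
  by rewrite rE pr1_pairing pr2_pairing.
have rP : is_pseudo_equivalence r.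
  apply: pseudo_equivalence_of_elements=> [c|c d|c d e]; rewrite !rE.
  - exact: refl.
  - exact: sym.
  - exact: trans.
by exists (PerObj rP), m; split=> // x /mD.
Qed.

(** Pairs with [a x ≈ b y], compared componentwise. The elementwise form lets mediating arrows be
    defined by relations. *)
Lemma pullback_exists (A B I : Cex) (a : A ~> I) (b : B ~> I) :
  exists (Q : Cex) (p1 : Q ~> A) (p2 : Q ~> B),
    [/\ forall w, app a (app p1 w) ≈ app b (app p2 w),
        forall x y, app a x ≈ app b y ->
          exists w, app p1 w ≈ x /\ app p2 w ≈ y
      & forall w w', app p1 w ≈ app p1 w' -> app p2 w ≈ app p2 w' -> w ≈ w'].
Proof.
pose AB := per_base A ×[P] per_base B.
have [|||||Q [m [mD Dm mE]]] := @subquotient_exists AB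
  (fun w => app a (pr1 _ _ ∘ w) ≈ app b (pr2 _ _ ∘ w))
  (fun w w' => pr1 _ _ ∘ w ≈ pr1 _ _ ∘ w' /\ pr2 _ _ ∘ w ≈ pr2 _ _ ∘ w').
- solve_definable.
- solve_definable.
- by move=> x _; split; apply: eqv_refl.
- by move=> x y _ _ [? ?]; split; apply: eqv_sym.
- by move=> x y z _ _ _ [xy1 xy2] [yz1 yz2]; split;
    [apply: eqv_trans yz1|apply: eqv_trans yz2].
have [|||p1 p1E] := @ex_hom_of_relation Q A (fun w x => pr1 _ _ ∘ (m ∘ w) = x).
- solve_definable.
- by move=> w; exists (pr1 _ _ ∘ (m ∘ w)).
- by move=> w w' x x' /mE[ww' _] <- <-.
have [|||p2 p2E] := @ex_hom_of_relation Q B (fun w x => pr2 _ _ ∘ (m ∘ w) = x).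
- solve_definable.
- by move=> w; exists (pr2 _ _ ∘ (m ∘ w)).
- by move=> w w' x x' /mE[_ ww'] <- <-.
exists Q, p1, p2; split.
- move=> w; apply: eqv_trans (app_eqv a (p1E _ _ erefl)) _.
  by apply: eqv_trans (mD w) (app_eqv b (eqv_sym (p2E _ _ erefl))).
- move=> x y xy; have [|w wE] := Dm ⟨x, y⟩.
    by rewrite pr1_pairing pr2_pairing.
  by exists w; split; [apply: p1E|apply: p2E]; rewrite wE ?pr1_pairing ?pr2_pairing.
- move=> w w' w1 w2; apply/mE; split.
    by apply: eqv_trans (eqv_sym (p1E _ _ erefl)) (eqv_trans w1 (p1E _ _ erefl)).
  by apply: eqv_trans (eqv_sym (p2E _ _ erefl)) (eqv_trans w2 (p2E _ _ erefl)).
Qed.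

(** * Exponentials of fibres *)

(* The full family is taken over the presentations of [{(i, x) | i ≈ a x}] and
   [{(i, x, y) | i ≈ a x, i ≈ b y}], so that a relation from the fibre of [a] to
   the fibre of [b] becomes a pseudo-relation. *)
Lemma full_fibre_relations (A B I : Cex) (a : A ~> I) (b : B ~> I) :
  exists (F : C) (phi : F ~> per_base I)
    (V : elt F -> elt (per_base A) -> elt (per_base B) -> Prop),
    [/\ definable3 V,
        forall c x y, V c x y -> phi ∘ c ≈ app a x /\ phi ∘ c ≈ app b y,
        forall c x, phi ∘ c ≈ app a x -> exists y, V c x y
      & forall i (W : elt (per_base A) -> elt (per_base B) -> Prop),
          definable2 W -> (forall x y, W x y -> i ≈ app b y) ->
          (forall x, i ≈ app a x -> exists y, W x y) ->
          exists c, phi ∘ c = i /\ forall x y, V c x y -> W x y].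
Proof.
have [|X [p [q [pqP pq]]]] := @definable2_cover _ _
  (fun i x => i ≈ app a x); first by solve_definable.
have [|Y [g [v [gvP gv]]]] := @definable2_cover X _
  (fun u y => p ∘ u ≈ app b y); first by solve_definable.
have [F [Pf [phi [alpha [[fam1 fam2] full]]]]] := closedC g p.
(* The member of the family at [c] relates elements of the covers [X] and [Y]; [V c] is its image
   along [q] and [v]. *)
exists F, phi, (fun c x y => exists (u : elt X) (t : elt Y),
  in_image alpha ⟨⟨c, u⟩, t⟩ /\ q ∘ u = x /\ v ∘ t = y); split.
- solve_definable.
- move=> c x y [u [t [cut [<- <-]]]].
  have pu : p ∘ u = phi ∘ c by apply/fam2; exists t.
  by rewrite -pu; split; [apply: pqP|rewrite -(fam1 _ _ _ cut); apply: gvP].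
- move=> c x /pq[u [pu qu]]; have [t cut] := (fam2 c u).1 pu.
  by exists (v ∘ t), u, t.
- move=> i W dW Wb Wtot.
  (* Pulling [W] back to the covers gives a pseudo-relation over [g], [p] at [i], which fullness
     refines. *)
  have [R [r rE]] : definable2 (fun (u : elt X) (t : elt Y) =>
    p ∘ u = i /\ g ∘ t = u /\ W (q ∘ u) (v ∘ t)) by solve_definable.
  have {}rE u t : in_image r ⟨u, t⟩ <->
      p ∘ u = i /\ g ∘ t = u /\ W (q ∘ u) (v ∘ t).
    by rewrite rE pr1_pairing pr2_pairing.
  have [|c [ci cr]] := full i R r.
    split=> [u t /rE[_ []]//|u]; split=> [pu|[t /rE[]]//].
    have [|y Wy] := Wtot (q ∘ u); first by rewrite -pu.
    have [|t [gt vt]] := gv u y; first by rewrite pu; apply: Wb Wy.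
    by exists t; apply/rE; rewrite vt.
  exists c; split=> // x y [u [t [/cr/rE[_ [_ Wut]] [<- <-]]]]; exact: Wut.
Qed.

(** Elements of [E] are functions between fibres with graph [V c]. The clauses say that graphs are
    total and single-valued, that equal graphs give equal elements, and that every definable family
    of functions is classified by an arrow. *)
Lemma fibre_exponential (A B I : Cex) (a : A ~> I) (b : B ~> I) :
  exists (E : Cex) (e : E ~> I)
    (V : elt (per_base E) -> elt (per_base A) -> elt (per_base B) -> Prop),
    [/\ definable3 V,
        (forall c x y, V c x y -> app e c ≈ app a x /\ app e c ≈ app b y) /\
        (forall c x, app e c ≈ app a x -> exists y, V c x y),
        forall c c' x x' y y', c ≈ c' -> x ≈ x' -> V c x y -> V c' x' y' -> y ≈ y',
        forall c c', app e c ≈ app e c' ->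
          (forall x y y', V c x y -> V c' x y' -> y ≈ y') -> c ≈ c'
      & forall (Z : Cex) (k : Z ~> I)
          (T : elt (per_base Z) -> elt (per_base A) -> elt (per_base B) -> Prop),
          definable3 T ->
          (forall z x y, T z x y -> app k z ≈ app b y) ->
          (forall z x, app k z ≈ app a x -> exists y, T z x y) ->
          (forall z z' x x' y y', z ≈ z' -> x ≈ x' ->
             T z x y -> T z' x' y' -> y ≈ y') ->
          exists h : Z ~> E, forall z, app e (app h z) ≈ app k z /\
            forall x y, V (app h z) x y -> exists2 y', T z x y' & y ≈ y'].
Proof.
have [F [phi [V [dV Vfib Vtot Vfull]]]] := full_fibre_relations a b.
(* On the diagonal, [Q c c] says that [V c] is single-valued, so one formula gives both the domain
   and the equivalence. *)
pose Q c c' := phi ∘ c ≈ phi ∘ c' /\ forall x x' y y',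
  V c x y -> V c' x' y' -> x ≈ x' -> y ≈ y'.
have dQ : definable2 Q by rewrite /Q; solve_definable.
have [|||||E [m [mD Dm mE]]] := @subquotient_exists F (fun c => Q c c) Q.
- solve_definable.
- exact: dQ.
- by [].
- move=> c c' _ _ [cc' H]; split; first exact: eqv_sym.
  by move=> x x' y y' Vc Vc' xx'; apply: eqv_sym; apply: H Vc' Vc (eqv_sym xx').
- move=> c1 c2 c3 _ _ _ [c12 H12] [c23 H23]; split; first exact: eqv_trans c23.
  move=> x x' y y' Vc1 Vc3 xx'.
  (* A value of the middle relation at [x] links the two outer ones. *)
  have [y2 Vc2] : exists y2, V c2 x y2.
    by apply: Vtot; apply: eqv_trans (eqv_sym c12) (Vfib _ _ _ Vc1).1.
  by apply: eqv_trans (H12 _ _ _ _ Vc1 Vc2 (eqv_refl x)) (H23 _ _ _ _ Vc2 Vc3 xx').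
have [|||e eE] := @ex_hom_of_relation E I (fun c i => phi ∘ (m ∘ c) = i).
- solve_definable.
- by move=> c; exists (phi ∘ (m ∘ c)).
- by move=> c c' i i' /mE[cc' _] <- <-.
have {}eE c : app e c ≈ phi ∘ (m ∘ c) by apply: eE.
exists E, e, (fun c => V (m ∘ c)); split.
- solve_definable.
- split=> [c x y /Vfib[ca cb]|c x cx].
    by split; apply: eqv_trans (eE c) _.
  by apply: Vtot; apply: eqv_trans (eqv_sym (eE c)) cx.
- by move=> c c' x x' y y' /mE[_ H] xx' Vc Vc'; apply: H Vc Vc' xx'.
- move=> c c' cc' H; apply/mE; split.
    by apply: eqv_trans (eqv_sym (eE c)) (eqv_trans cc' (eE c')).
  move=> x x' y y' Vc Vc' xx'.
  have [y2 Vc2] : exists y2, V (m ∘ c') x y2.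
    apply: Vtot; apply: eqv_trans (eqv_sym (eE c')) _.
    by apply: eqv_trans (eqv_sym cc') (eqv_trans (eE c) (Vfib _ _ _ Vc).1).
  apply: eqv_trans (H _ _ _ Vc Vc2) _.
  by case: (mD c') => _; apply; [exact: Vc2|exact: Vc'|].
- move=> Z k T dT Tb Ttot Tresp.
  (* Fullness gives an index whose relation lies inside [T z]. It is single-valued since [T z] is,
     and any two such indices are [Q]-related. *)
  pose S z c := phi ∘ (m ∘ c) = app k z /\ forall x y, V (m ∘ c) x y -> T z x y.
  have tot z : exists c, S z c.
    have [|||c [ck cT]] := Vfull (app k z) (T z).
    - solve_definable.
    - exact: Tb.
    - exact: Ttot.
    have [|d dc] := Dm c; last by exists d; rewrite /S dc.
    split; first exact: eqv_refl.
    move=> x x' y y' /cT Ty /cT Ty' xx'; exact: Tresp (eqv_refl z) xx' Ty Ty'.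
  have [||h hE] := @ex_hom_of_relation Z E S _ tot.
  + rewrite /S; solve_definable.
  + move=> z z' c c' zz' [ck cT] [ck' cT']; apply/mE; split.
      by rewrite ck ck'; apply: app_eqv.
    move=> x x' y y' /cT Ty /cT' Ty' xx'; exact: Tresp zz' xx' Ty Ty'.
  exists h => z; have [c [ck cT]] := tot z.
  have hc := hE z c (conj ck cT); split.
    by apply: eqv_trans (app_eqv e hc) _; rewrite -ck; apply: eE.
  (* [app h z] is only equivalent to the index [c], so its values match those of [T z] up to [≈]. *)
  move=> x y Vy; have [_ H] := (mE _ _).1 hc.
  have [y' Vy'] : exists y', V (m ∘ c) x y'.
    apply: Vtot; rewrite ck; apply: eqv_trans _ (Vfib _ _ _ Vy).1.
    by rewrite -ck; apply: eqv_sym; case: ((mE _ _).1 hc).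
  by exists y'; [apply: cT|apply: H Vy Vy' (eqv_refl x)].
Qed.

(** * The slices *)

(** Turns existence into the operations of the record by choice; [K] carries an extra property of
    the chosen cones along. *)
Lemma finite_products_of_universal (D : category)
    (K : forall X Y Q : D, (Q ~> X) -> (Q ~> Y) -> Prop) :
  has_terminal D ->
  (forall X Y : D, exists (Q : D) (p : Q ~> X) (q : Q ~> Y), K X Y Q p q /\
     forall Z (f : Z ~> X) (g : Z ~> Y), exists! h, p ∘ h = f /\ q ∘ h = g) ->
  exists SP : finite_products D, forall X Y : D,
    K X Y (X ×[SP] Y) (pr1 X Y) (pr2 X Y).
Proof.
move=> /cid[T term] prd.
pose bg X := cid (term X).
pose Q X Y := cid (prd X Y); pose p X Y := cid (svalP (Q X Y)).
pose q X Y := cid (svalP (p X Y)); pose univ X Y := (svalP (q X Y)).2.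
pose med Z X Y f g := cid (univ X Y Z f g).
unshelve eexists (@FiniteProducts D T (fun X => sval (bg X)) _
  (fun X Y => sval (Q X Y)) (fun X Y => sval (p X Y)) (fun X Y => sval (q X Y))
  (fun Z X Y f g => sval (med Z X Y f g)) _ _ _).
- by move=> X f; apply: esym; apply: (svalP (bg X)).2.
- by move=> Z X Y f g; case: (svalP (med Z X Y f g)) => -[].
- by move=> Z X Y f g; case: (svalP (med Z X Y f g)) => -[].
- by move=> Z X Y h; apply: esym; apply: (svalP (med Z X Y _ _)).2.
- by move=> X Y; exact: (svalP (q X Y)).1.
Qed.

Lemma exact_completion_terminal : has_terminal Cex.
Proof.
have [|||||T [m [_ Tm mE]]] := @subquotient_exists (one P)
  (fun _ => True) (fun _ _ => True) => //.
- by exists (one P), (idm _) => x; split=> // _; exists x; rewrite comp_idl.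
- by exists (one P ×[P] one P), (idm _) => x; split=> // _; exists x;
    rewrite comp_idl.
have [t _] := Tm (idm _) I.
exists T => X; have [|||f _] := @ex_hom_of_relation X T (fun _ y => y = t).
- solve_definable.
- by exists t.
- by move=> x x' y y' _ -> ->; apply: eqv_refl.
by exists f; split=> // g _; apply: app_ext => x; apply/mE.
Qed.

Local Notation sapp h := (app (sval h)).

Lemma slice_app (I : Cex) (A B : slice I) (h : A ~> B)
    (x : elt (per_base (slice_dom A))) :
  app (slice_map B) (sapp h x) ≈ app (slice_map A) x.
Proof.
apply: eqv_trans (eqv_sym (app_comp _ _ _)) _.
by rewrite (svalP h); apply: eqv_refl.
Qed.

Lemma slice_app_comp (I : Cex) (A B D : slice I) (g : B ~> D) (f : A ~> B)
    (x : elt (per_base (slice_dom A))) :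
  sapp (g ∘ f) x ≈ sapp g (sapp f x).
Proof. exact: app_comp. Qed.

Lemma slice_app_ext (I : Cex) (A B : slice I) (f g : A ~> B) :
  (forall x, sapp f x ≈ sapp g x) -> f = g.
Proof. by move=> fg; apply: slice_hom_eq; apply: app_ext. Qed.

Lemma slice_hom_of_relation (I : Cex) (A B : slice I)
    (S : elt (per_base (slice_dom A)) -> elt (per_base (slice_dom B)) -> Prop) :
  definable2 S -> (forall x, exists y, S x y) ->
  (forall x x' y y', x ≈ x' -> S x y -> S x' y' -> y ≈ y') ->
  (forall x y, S x y -> app (slice_map B) y ≈ app (slice_map A) x) ->
  exists f : A ~> B, forall x y, S x y -> sapp f x ≈ y.
Proof.
move=> dS tot resp over; have [f fE] := ex_hom_of_relation dS tot resp.
have fo : slice_map B ∘ f = slice_map A.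
  apply: app_ext => x; have [y Sxy] := tot x.
  apply: eqv_trans (app_comp _ _ _) _.
  exact: eqv_trans (app_eqv _ (fE _ _ Sxy)) (over _ _ Sxy).
by exists (exist _ f fo : slice_hom A B).
Qed.

(** Slice arrows make the projections compatible; what remains of a pullback is that compatible
    pairs are covered and that projections are jointly injective up to [≈]. *)
Definition is_fibre_product (I : Cex) (A B Q : slice I) (p : Q ~> A) (q : Q ~> B) :=
  (forall x y, app (slice_map A) x ≈ app (slice_map B) y ->
     exists w, sapp p w ≈ x /\ sapp q w ≈ y) /\
  (forall w w', sapp p w ≈ sapp p w' -> sapp q w ≈ sapp q w' -> w ≈ w').

Lemma slice_products (I : Cex) :
  exists SP : finite_products (slice I), forall A B : slice I,
    is_fibre_product (pr1 A B : A ×[SP] B ~> A) (pr2 A B).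
Proof.
apply: (@finite_products_of_universal _ (@is_fibre_product I)).
  exists (SliceObj (idm I) : slice I) => A.
  exists (exist _ (slice_map A) (comp_idl _) : slice_hom A (SliceObj (idm I))).
  split=> // h _; apply: slice_hom_eq; have := svalP h.
  by rewrite /= ex_comp_idl => ->.
move=> A B; have [Q [p [q [pq Qpq inj]]]] :=
  pullback_exists (slice_map A) (slice_map B).
pose QQ : slice I := SliceObj (slice_map A ∘ p).
have qo : slice_map B ∘ q = slice_map QQ.
  apply: app_ext => w; apply: eqv_trans (app_comp _ _ _) _.
  by apply: eqv_trans (eqv_sym (pq w)) (eqv_sym (app_comp _ _ _)).
pose pp : QQ ~> A := exist _ p erefl; pose qq : QQ ~> B := exist _ q qo.
exists QQ, pp, qq; split=> // Z f g.
have [||||h hE] := @slice_hom_of_relation I Z QQ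
  (fun z w => app p w ≈ sapp f z /\ app q w ≈ sapp g z).
- solve_definable.
- move=> z; apply: Qpq; apply: eqv_trans (slice_app f z) _.
  exact: eqv_sym (slice_app g z).
- move=> z z' w w' zz' [w1 w2] [w1' w2']; apply: inj.
    by apply: eqv_trans w1 (eqv_trans (app_eqv _ zz') (eqv_sym w1')).
  by apply: eqv_trans w2 (eqv_trans (app_eqv _ zz') (eqv_sym w2')).
- move=> z w [w1 _]; apply: eqv_trans (app_comp _ _ _) _.
  by apply: eqv_trans (app_eqv _ w1) (slice_app f z).
have hpq z : sapp pp (sapp h z) ≈ sapp f z /\ sapp qq (sapp h z) ≈ sapp g z.
  have [|w [w1 w2]] := Qpq (sapp f z) (sapp g z).
    by apply: eqv_trans (slice_app f z) _; apply: eqv_sym (slice_app g z).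
  have hw := hE z w (conj w1 w2).
  by split; [apply: eqv_trans w1|apply: eqv_trans w2]; apply: app_eqv.
exists h; split.
  split; apply: slice_app_ext => z; apply: eqv_trans (slice_app_comp _ _ _) _;
    by case: (hpq z).
move=> h' [h'f h'g]; apply: slice_app_ext => z.
by apply: hE; rewrite -h'f -h'g; split; apply: eqv_sym; apply: slice_app_comp.
Qed.

(** * Exponentials in the slices *)

Lemma slice_cartesian_closed (I : Cex) : cartesian_closed (slice I).
Proof.
have [SP prodP] := slice_products I; exists SP => A B.
have [E0 [e [V [dV [Vfib Vtot] Vresp Vinj Vuniv]]]] :=
  fibre_exponential (slice_map A) (slice_map B).
pose E : slice I := SliceObj e.
have fib (Z : slice I) (w : elt (per_base (slice_dom (Z ×[SP] A)))) :
    app (slice_map Z) (sapp (pr1 Z A) w) ≈ app (slice_map A) (sapp (pr2 Z A) w).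
  exact: eqv_trans (slice_app _ _) (eqv_sym (slice_app _ _)).
have [||||ev evE] := @slice_hom_of_relation I (E ×[SP] A) B
  (fun w y => V (sapp (pr1 E A) w) (sapp (pr2 E A) w) y).
- solve_definable.
- by move=> w; apply: Vtot; exact: (fib E w).
- by move=> w w' y y' ww'; apply: Vresp; apply: app_eqv.
- move=> w y /Vfib[_ ey]; apply: eqv_trans (eqv_sym ey) (slice_app (pr1 E A) w).
exists E, ev => Z f.
have pmap (h : Z ~> E) w :
    sapp (pr1 E A) (sapp (prod_map SP h (idm A)) w) ≈ sapp h (sapp (pr1 Z A) w) /\
    sapp (pr2 E A) (sapp (prod_map SP h (idm A)) w) ≈ sapp (pr2 Z A) w.
  split; apply: eqv_trans (eqv_sym (slice_app_comp _ _ _)) _.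
    by rewrite /prod_map pr1_pairing; apply: slice_app_comp.
  by rewrite /prod_map pr2_pairing comp_idl; apply: eqv_refl.
(* Computes evaluation after [h × id]: its value at [w] is any [V]-value of [h] at the two
   projections of [w]. *)
have evh (h : Z ~> E) w y :
    V (sapp h (sapp (pr1 Z A) w)) (sapp (pr2 Z A) w) y ->
    sapp (ev ∘ prod_map SP h (idm A)) w ≈ y.
  move=> Vy; apply: eqv_trans (slice_app_comp _ _ _) _.
  have [y' Vy'] := Vtot _ _ (fib E (sapp (prod_map SP h (idm A)) w)).
  apply: eqv_trans (evE _ _ Vy') _; have [h1 h2] := pmap h w.
  exact: Vresp h1 h2 Vy' Vy.
have [Zex Zinj] := prodP Z A.
(* The curried graph of [f], where [w] stands for the pair of [z] and [x] up to [≈]. *)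
pose T z x y := exists w : elt (per_base (slice_dom (Z ×[SP] A))),
  sapp (pr1 Z A) w ≈ z /\ sapp (pr2 Z A) w ≈ x /\ y = sapp f w.
have [||||h hE] := Vuniv (slice_dom Z) (slice_map Z) T.
- rewrite /T; solve_definable.
- move=> z x y [w [wz [_ ->]]].
  apply: eqv_trans (app_eqv _ (eqv_sym wz)) _.
  by apply: eqv_trans (slice_app _ _) (eqv_sym (slice_app f w)).
- by move=> z x /Zex[w [wz wx]]; exists (sapp f w), w.
- move=> z z' x x' y y' zz' xx' [w [wz [wx ->]]] [w' [wz' [wx' ->]]].
  apply: app_eqv; apply: Zinj.
    by apply: eqv_trans wz (eqv_trans zz' (eqv_sym wz')).
  by apply: eqv_trans wx (eqv_trans xx' (eqv_sym wx')).
have ho : slice_map E ∘ h = slice_map Z.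
  by apply: app_ext => z; apply: eqv_trans (app_comp _ _ _) (hE z).1.
pose hh : Z ~> E := exist _ h ho.
have Vh (k : Z ~> E) z x : app (slice_map Z) z ≈ app (slice_map A) x ->
    exists y, V (sapp k z) x y.
  by move=> zx; apply: Vtot; apply: eqv_trans (slice_app k z) zx.
exists hh; split.
  apply: slice_app_ext => w; have [y Vy] := Vh hh _ _ (fib Z w).
  apply: eqv_trans (evh hh w y Vy) _.
  (* The value comes from some [w'] with the projections of [w], so joint injectivity gives
     [w' ≈ w]. *)
  have [_ [w' [w1 [w2 ->]]] yw'] := (hE _).2 _ _ Vy.
  by apply: eqv_trans yw' (app_eqv _ (Zinj _ _ w1 w2)).
(* For uniqueness, elements of [E] are compared by their values, and both values at [x] agree with
   that of [f] at a pair over [z] and [x]. *)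
move=> h' h'f; apply: slice_app_ext => z; apply: Vinj.
  by apply: eqv_trans (slice_app hh z) (eqv_sym (slice_app h' z)).
move=> x y y' Vy Vy'.
have [_ [w [wz [wx ->]]] yw] := (hE z).2 _ _ Vy.
apply: eqv_trans yw _; rewrite -h'f.
have [y2 Vy2] := Vh h' _ _ (fib Z w).
apply: eqv_trans (evh h' w y2 Vy2) _.
exact: Vresp (app_eqv _ wz) wx Vy2 Vy'.
Qed.

End ExactCompletionLCC.

Theorem theorem4p9 (C : category) (P : finite_products C)
    (weq : has_weak_equalisers C)
    (choiceC : forall Y : C, choice_object P Y)
    (closedC : closed_for_pseudo_relations P) :
  locally_cartesian_closed (exact_completion P).
Proof.
split; first exact: exact_completion_terminal.
by move=> I; apply: slice_cartesian_closed.
Qed.
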